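(* Let $G$ be a profinite group and $H$ a closed normal subgroup such that $\Gamma=G/H$ is procyclic; let $\pi:G\to\Gamma$ be the quotient map and, for a positive integer $n$, let $G_n=\pi^{-1}(n\Gamma)$. Let $k$ be a locally compact field, $d$ a positive integer, $V$ a $d$-dimensional $k$-vector space, and $\rho:G\to\mathrm{Aut}_k(V)$ a continuous linear representation such that the $G$-module $V$ is semisimple. Then there exists a positive integer $n$ depending only on $d$ such that the center of $\mathrm{End}_H(V)$ lies in $\mathrm{End}_{G_n}(V)$.
   Context: $\Gamma$ is written additively, so $n\Gamma$ is the image of multiplication by $n$ on $\Gamma$, an open subgroup of index dividing $n$; $G_n$ is an open normal subgroup of $G$ containing $H$. $\mathrm{End}_{H}(V)$, $\mathrm{End}_{G_n}(V)$ denote the $k$-linear endomorphisms of $V$ commuting with $\rho(H)$, resp. $\rho(G_n)$. *)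

(* Defs.v *)
From HB Require Import structures.
From mathcomp Require Import all_boot all_algebra.
From mathcomp Require Import all_classical topology tvs.
Set Implicit Arguments.
Unset Strict Implicit.
Unset Printing Implicit Defensive.
Import GRing.Theory.
Local Open Scope classical_set_scope.

HB.mixin Record Topological_isTopologicalGroup G
    & Topological G & Group G := {
  mulg_continuous : continuous (fun x : G * G => (x.1 * x.2)%g) ;
  invg_continuous : continuous (fun x : G => (x^-1)%g) ;
}.

#[short(type="topologicalGroupType")]
HB.structure Definition TopologicalGroup :=
  {G of Topological G & Group G & Topological_isTopologicalGroup G}.

HB.mixin Record TopologicalZmodule_isTopologicalField k
    & TopologicalZmodule k & GRing.Field k := {
  mulr_continuous : continuous (fun x : k * k => (x.1 * x.2)%R) ;
  (* nothing is required at 0, where mathcomp sets 0^-1 = 0 *)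
  invr_continuous :
    forall x : k, x != 0%R -> {for x, continuous (fun y : k => (y^-1)%R)} ;
}.

#[short(type="topologicalFieldType")]
HB.structure Definition TopologicalField :=
  {k of TopologicalZmodule k & GRing.Field k
      & TopologicalZmodule_isTopologicalField k}.

(* Local compactness includes the Hausdorff axiom, as in Bourbaki; the
   discrete topology is allowed. *)
Definition locally_compact_field (k : topologicalFieldType) : Prop :=
  hausdorff_space k /\ locally_compact [set: k].

Definition profinite (G : topologicalGroupType) : Prop :=
  [/\ compact [set: G], hausdorff_space G & totally_disconnected [set: G]].

Definition cyclic_subgroup (G : groupType) (x : G) : set G :=
  [set y | exists n : nat, y = (x ^+ n)%g \/ y = (x ^- n)%g].

Definition procyclic (G : topologicalGroupType) : Prop :=
  profinite G /\ exists x : G, closure (cyclic_subgroup x) = [set: G].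

Record closed_normal_subgroup (G : topologicalGroupType) (H : set G) : Prop := {
  cns_one : H 1%g ;
  cns_mul : forall x y, H x -> H y -> H (x * y)%g ;
  cns_inv : forall x, H x -> H (x^-1)%g ;
  cns_conj : forall g x, H x -> H (x ^ g)%g ;
  cns_closed : closed H
}.

(* [quotient_group_map H pi] says that the topological group [Gamma], together
   with [pi], is the quotient G / H : [pi] is a surjective homomorphism with
   kernel [H], and [Gamma] carries the quotient topology. This determines
   [(Gamma, pi)] up to a unique isomorphism of topological groups. *)
Record quotient_group_map (G Gamma : topologicalGroupType) (H : set G)
    (pi : G -> Gamma) : Prop := {
  qgm_morph : forall x y, pi (x * y)%g = (pi x * pi y)%g ;
  qgm_surj : forall c, exists x, pi x = c ;
  qgm_ker : forall x, pi x = 1%g <-> H x ;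
  qgm_open : forall U : set Gamma, open U <-> open (pi @^-1` U)
}.

(* The group law of [Gamma] is multiplicative here, so this is n Gamma. *)
Definition power_image (Gamma : groupType) (n : nat) : set Gamma :=
  [set y | exists x : Gamma, y = (x ^+ n)%g].

Definition preimage_power (G Gamma : topologicalGroupType) (pi : G -> Gamma)
  (n : nat) : set G := pi @^-1` (power_image n).

Section Representations.
Variables (G : topologicalGroupType) (k : topologicalFieldType).
Variable V : vectType k.
Implicit Types (rho : G -> 'End(V)) (U W : {vspace V}).

(* Homomorphisms from the group [G] to Aut_k(V): the two equations force every
   [rho g] to be invertible, with inverse [rho g^-1]. *)
Definition linear_rep rho : Prop :=
  rho 1%g = \1%VF /\ forall x y, rho (x * y)%g = (rho x \o rho y)%VF.

(* Aut_k(V) has the topology of GL_d(k), i.e. the one induced from the matrix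
   space M_d(k) through a basis of V; it does not depend on the basis. As
   inversion is continuous on GL_d(k), the topology induced by M_d(k) is the
   group topology. *)
Definition continuous_rep rho : Prop :=
  continuous (fun g => passmx.mxof (vbasis {:V}) (vbasis {:V}) (rho g)).

Definition submodule rho U : Prop := forall g, (rho g @: U <= U)%VS.

Definition simple_submodule rho U : Prop :=
  [/\ submodule rho U, U <> 0%VS &
      forall W, submodule rho W -> (W <= U)%VS -> W = 0%VS \/ W = U].

Definition semisimple_rep rho : Prop :=
  exists (m : nat) (U : 'I_m -> {vspace V}),
    [/\ forall i, simple_submodule rho (U i),
        directv (\sum_i U i)%VS & (\sum_i U i)%VS = fullv].

Definition End_rep rho (S : set G) : set 'End(V) :=
  [set f | forall s, S s -> (f \o rho s = rho s \o f)%VF].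

Definition centerEnd (A : set 'End(V)) : set 'End(V) :=
  [set f | A f /\ forall g, A g -> (f \o g = g \o f)%VF].

End Representations.

(* Main.v *)
(* The conjugation action of G on the center Z of End_H(V) has finite order
   bounded in terms of d = dim V, for purely algebraic reasons. By Clifford's
   theorem V is a sum of at most d simple H-submodules W. Since W is the image
   of an H-equivariant projection, Z stabilizes W, and by Schur's lemma Z acts on
   W through a field. For z in Z and g in G, the conjugates of z by the powers of
   g are roots in Z of the characteristic polynomial of z, so they have at most d
   distinct restrictions to each W. By the pigeonhole principle two of the
   conjugates by g^i with 0 <= i <= (d+1)^d coincide, hence g^n commutes with z
   for n = ((d+1)^d)!. *)
Require Import Defs.
From HB Require Import structures.
From mathcomp Require Import all_boot all_algebra.
From mathcomp Require Import all_classical topology tvs.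
From mathcomp Require Import zify.
Local Open Scope classical_set_scope.
Set Implicit Arguments.
Unset Strict Implicit.
Unset Printing Implicit Defensive.
Import GRing.Theory.

(** * Stable and simple subspaces for a set of matrices *)

Section MatrixModules.
Local Open Scope ring_scope.
Variables (F : fieldType) (n : nat).
Implicit Types (S : set 'M[F]_n) (f g h s z : 'M[F]_n).

(** Matrices act on row vectors from the right; a subspace is the row space of [U]. *)
Definition stable_under S m (U : 'M[F]_(m, n)) : Prop :=
  forall s, S s -> stablemx U s.

(** [U] may have any number of rows, which allows row bases. Square [X] suffice, since they
    represent all subspaces. *)
Definition simple_mx S m (U : 'M[F]_(m, n)) : Prop :=
  [/\ stable_under S U, U != 0 &
      forall X : 'M_n, stable_under S X -> (X <= U)%MS -> X != 0 -> (U <= X)%MS].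

Definition commutant S : set 'M[F]_n := [set f | forall s, S s -> comm_mx f s].

Definition center_commutant S : set 'M[F]_n :=
  commutant S `&` commutant (commutant S).

Lemma stable_under_eqmx S m1 m2 (U : 'M_(m1, n)) (U' : 'M_(m2, n)) :
  (U :=: U')%MS -> stable_under S U -> stable_under S U'.
Proof. by move=> eqU US s /US; rewrite (eqmx_stable _ eqU). Qed.

Lemma simple_mx_eqmx S m1 m2 (U : 'M_(m1, n)) (U' : 'M_(m2, n)) :
  (U :=: U')%MS -> simple_mx S U -> simple_mx S U'.
Proof.
move=> eqU [US U0 Umin]; split; first exact: stable_under_eqmx US.
  by rewrite -mxrank_eq0 -eqU mxrank_eq0.
by move=> X XS; rewrite -!eqU; apply: Umin.
Qed.

Lemma stable_addsmx S (U U' : 'M_n) :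
  stable_under S U -> stable_under S U' -> stable_under S (U + U')%MS.
Proof. by move=> US U'S s Ss; rewrite stableDmx ?US ?U'S. Qed.

Lemma stable_capmx S m1 m2 (U : 'M_(m1, n)) (U' : 'M_(m2, n)) :
  stable_under S U -> stable_under S U' -> stable_under S (U :&: U')%MS.
Proof.
move=> US U'S s Ss; rewrite sub_capmx.
apply/andP; split.
  by apply: submx_trans (US _ Ss); rewrite submxMr // capmxSl.
by apply: submx_trans (U'S _ Ss); rewrite submxMr // capmxSr.
Qed.

Lemma stable_sumsmx S (Ws : seq 'M_n) :
  (forall W, W \in Ws -> stable_under S W) ->
  stable_under S (\sum_(W <- Ws) W)%MS.
Proof.
elim: Ws => [|W Ws IH] WsS; first by rewrite big_nil => s _; rewrite mul0mx.
rewrite big_cons; apply: stable_addsmx; first by apply: WsS; rewrite mem_head.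
by apply: IH => X XWs; apply: WsS; rewrite inE XWs orbT.
Qed.

Lemma sumsmx_seqP m (Ws : seq 'M[F]_n) (X : 'M_(m, n)) :
  reflect (forall W, W \in Ws -> (W <= X)%MS) (\sum_(W <- Ws) W <= X)%MS.
Proof.
elim: Ws => [|W Ws IH]; first by rewrite big_nil sub0mx; apply: ReflectT.
rewrite big_cons addsmx_sub; apply: (iffP andP) => [[WX /IH WsX] Y|WsX].
  by rewrite inE => /predU1P[->|/WsX].
split; first by rewrite WsX ?mem_head.
by apply/IH => Y YWs; rewrite WsX // inE YWs orbT.
Qed.

Lemma simple_sub_or_cap0 S (W U : 'M_n) :
  simple_mx S W -> stable_under S U -> (W <= U)%MS \/ (W :&: U)%MS = 0.
Proof.
move=> [WS _ Wmin] US; have [->|cap0] := eqVneq (W :&: U)%MS 0; first by right.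
left; apply: submx_trans (Wmin _ (stable_capmx WS US) (capmxSl _ _) cap0) _.
exact: capmxSr.
Qed.

(** Induction on the rank: a nonzero stable subspace that is not simple contains a strictly smaller
    nonzero stable one. *)
Lemma exists_simple S (U : 'M_n) : stable_under S U -> U != 0 ->
  exists2 W : 'M_n, simple_mx S W & (W <= U)%MS.
Proof.
have [r] := ubnP (\rank U); elim: r U => // r IH U ltUr US U0.
have [?|notsimple] := pselect (simple_mx S U); first by exists U.
have [X [XS XU X0 nUX]] : exists X : 'M_n,
    [/\ stable_under S X, (X <= U)%MS, X != 0 & ~~ (U <= X)%MS].
  apply: contrapT => noX; apply: notsimple; split=> // X XS XU X0.
  by apply: contrapT => /negP nUX; apply: noX; exists X.
have ltXU : (\rank X < \rank U)%N.
  by rewrite ltn_neqAle (mxrank_leqif_sup XU) nUX mxrankS.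
have [W Wsimple WX] := IH X (leq_trans ltXU ltUr) XS X0.
by exists W => //; apply: submx_trans WX XU.
Qed.

(** A simple submodule outside the current sum meets it in 0, so adjoining it raises the rank; this
    can happen at most [n] times. *)
Lemma exists_socle S : exists Ws : seq 'M_n,
  [/\ forall W, W \in Ws -> simple_mx S W,
      (size Ws <= n)%N &
      forall X : 'M_n, simple_mx S X -> (X <= \sum_(W <- Ws) W)%MS].
Proof.
pose good Ws := (forall W, W \in Ws -> simple_mx S W)
  /\ (size Ws <= \rank (\sum_(W <- Ws) W)%MS)%N.
pose full Ws := forall X : 'M_n, simple_mx S X -> (X <= \sum_(W <- Ws) W)%MS.
suff /(_ n.+1)[Ws [WsS ltWs] Wsfull] : forall r, exists2 Ws, good Ws &
    full Ws \/ (r <= size Ws)%N.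
  case: Wsfull => [Wsfull|]; last first.
    by rewrite ltnNge (leq_trans ltWs (rank_leq_row _)).
  by exists Ws; split=> //; apply: leq_trans ltWs (rank_leq_row _).
elim=> [|r [Ws [WsS ltWs] [Wsfull|ler]]].
- by exists [::]; [split=> [W|//]; rewrite in_nil | right].
- by exists Ws; [|left].
have [Wsfull|notfull] := pselect (full Ws); first by exists Ws; [|left].
have [X XS XWs] : exists2 X : 'M_n, simple_mx S X & ~ (X <= \sum_(W <- Ws) W)%MS.
  by apply: contrapT => noX; apply: notfull => X XS; apply: contrapT => ?;
    apply: noX; exists X.
exists (X :: Ws); last by right.
split=> [W|]; first by rewrite inE => /predU1P[->|/WsS].
have WsStab : stable_under S (\sum_(W <- Ws) W)%MS.
  by apply: stable_sumsmx => W /WsS[].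
have [//|cap0] := simple_sub_or_cap0 XS WsStab.
rewrite big_cons mxrank_disjoint_sum //= -add1n leq_add // lt0n mxrank_eq0.
by case: XS.
Qed.

(** As [g] normalizes [S], right multiplication by [g] or its inverse preserves [S]-stability. *)
Lemma simple_conj S g (W : 'M_n) : g \in unitmx ->
    (forall s, S s -> S (g *m s *m invmx g)) ->
    (forall s, S s -> S (invmx g *m s *m g)) ->
  simple_mx S W -> simple_mx S (W *m g).
Proof.
move=> gU gS Sg [WS W0 Wmin]; split=> [s Ss||X XS XWg X0].
- rewrite -mulmxA -[g *m s](mulmxKV gU) mulmxA submxMr //; exact/WS/gS.
- by apply: contraNneq W0 => Wg0; rewrite -(mulmxK gU W) Wg0 mul0mx.
have XgW : (W <= X *m invmx g)%MS.
  apply: Wmin => [s Ss||].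
  - have -> : X *m invmx g *m s = X *m (invmx g *m s *m g) *m invmx g.
      by rewrite !mulmxA mulmxK.
    by rewrite submxMr //; apply/XS/Sg.
  - by rewrite -(mulmxK gU W) submxMr.
  by apply: contraNneq X0 => Xg0; rewrite -(mulmxKV gU X) Xg0 mul0mx.
by rewrite -(mulmxKV gU X) submxMr.
Qed.

(* The sum of all simple [Hs]-submodules is stable under [Gs] and, by
   minimality of dimension, meets every simple [Gs]-submodule. *)
Lemma Clifford (Gs Hs : set 'M[F]_n) (Us : seq 'M[F]_n) :
    (forall g, Gs g -> g \in unitmx) ->
    (forall g, Gs g -> Gs (invmx g)) ->
    (forall g h, Gs g -> Hs h -> Hs (g *m h *m invmx g)) ->
    Hs `<=` Gs ->
    (forall U, U \in Us -> simple_mx Gs U) ->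
    (1%:M <= \sum_(U <- Us) U)%MS ->
  exists Ws : seq 'M_n,
    [/\ forall W, W \in Ws -> simple_mx Hs W, (size Ws <= n)%N &
        (1%:M <= \sum_(W <- Ws) W)%MS].
Proof.
move=> GU GV GH HG UsG Us1; have [Ws [WsH ltWs Wsfull]] := exists_socle Hs.
exists Ws; split=> //; apply: submx_trans Us1 _; apply/sumsmx_seqP => U UUs.
have [UG U0 Umin] := UsG _ UUs.
set T := (\sum_(W <- Ws) W)%MS in Wsfull *.
(* Proved in the form [T <= T *m invmx g]: each [W *m g] is again simple, hence inside [T]. *)
have TG : stable_under Gs T.
  move=> g Gg; rewrite -[X in (_ <= X)%MS](mulmxKV (GU _ Gg)) submxMr //.
  apply/sumsmx_seqP => W WWs; rewrite -(mulmxK (GU _ Gg) W) submxMr //.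
  apply: Wsfull; apply: simple_conj (WsH _ WWs); first exact: GU.
  - by move=> s; apply: GH.
  - by move=> s Hs_s; have := GH _ _ (GV _ Gg) Hs_s; rewrite invmxK.
have [W WH WU] : exists2 W : 'M_n, simple_mx Hs W & (W <= U)%MS.
  by apply: exists_simple => // h /HG; apply: UG.
have [//|cap0] := simple_sub_or_cap0 (UsG _ UUs) TG.
have [_ /negP[]] := WH; rewrite -submx0 -cap0 sub_capmx WU.
exact: Wsfull.
Qed.

(** * Stable complements, equivariant projections and the centre of the commutant *)

Lemma exists_stable_complement S (Ws : seq 'M_n) (U : 'M_n) :
    (forall W, W \in Ws -> simple_mx S W) ->
    (1%:M <= \sum_(W <- Ws) W)%MS -> stable_under S U ->
  exists U' : 'M_n,
    [/\ stable_under S U', (U :&: U')%MS = 0 & (1%:M <= U + U')%MS].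
Proof.
move=> WsS Ws1 US.
suff [U' [U'S cap0 WsU]] : exists U' : 'M_n,
    [/\ stable_under S U', (U :&: U')%MS = 0 & (\sum_(W <- Ws) W <= U + U')%MS].
  by exists U'; split=> //; apply: submx_trans WsU.
elim: Ws WsS {Ws1} => [|W Ws IH] WsS.
  by exists 0; rewrite big_nil capmx0 sub0mx; split=> // s _; rewrite mul0mx.
have [|U' [U'S cap0 WsU]] := IH.
  by move=> X XWs; apply: WsS; rewrite inE XWs orbT.
have WS : simple_mx S W by apply: WsS; rewrite mem_head.
(* Either [W] is already covered, or it is independent of [U + U'] and is adjoined to [U']. *)
have [WU|capW] := simple_sub_or_cap0 WS (stable_addsmx US U'S).
  by exists U'; rewrite big_cons addsmx_sub WU.
exists (W + U')%MS; split.
- by apply: stable_addsmx => //; case: WS.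
- apply/eqP; rewrite -mxrank_eq0.
  have := mxrank_sum_cap U (W + U')%MS.
  have -> : \rank (U + (W + U'))%MS = (\rank W + (\rank U + \rank U'))%N.
    by rewrite addsmxA (addsmxC U) -addsmxA !mxrank_disjoint_sum.
  have := mxrank_adds_leqif W U'; case=> + _.
  lia.
rewrite big_cons addsmx_sub; apply/andP; split.
  by rewrite addsmxA addsmxC addsmxA addsmxSr.
by rewrite (submx_trans WsU) // addsmxS // addsmxSr.
Qed.

(** With [e] and [e'] the two projections, [e s e = e s] because [U] is stable, and [e' s e = 0]
    because [U'] is; adding gives [s e = e s]. *)
Lemma proj_mx_commutant S (U U' : 'M_n) :
    stable_under S U -> stable_under S U' ->
    (U :&: U')%MS = 0 -> (1%:M <= U + U')%MS ->
  commutant S (proj_mx U U').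
Proof.
move=> US U'S cap0 full s Ss; rewrite /comm_mx; set e := proj_mx U U'.
have eU : (e <= U)%MS by rewrite -[e]mul1mx proj_mx_sub.
have e'U' : (proj_mx U' U <= U')%MS by rewrite -[proj_mx _ _]mul1mx proj_mx_sub.
have <- : e *m s *m e = e *m s.
  by rewrite proj_mx_id // (submx_trans (submxMr _ eU)) ?US.
have e's0 : proj_mx U' U *m s *m e = 0.
  by rewrite proj_mx_0 // (submx_trans (submxMr _ e'U')) ?U'S.
rewrite -[in RHS](mul1mx s) -(add_proj_mx cap0 full) !mul1mx.
by rewrite !mulmxDl e's0 addr0.
Qed.

(* [U] is the image of an [S]-equivariant projection, with which [z] commutes. *)
Lemma center_commutant_stable S (Ws : seq 'M_n) (U : 'M_n) z :
    (forall W, W \in Ws -> simple_mx S W) ->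
    (1%:M <= \sum_(W <- Ws) W)%MS -> stable_under S U ->
  center_commutant S z -> stablemx U z.
Proof.
move=> WsS Ws1 US [_ zC].
have [U' [U'S cap0 full]] := exists_stable_complement WsS Ws1 US.
have eC := proj_mx_commutant US U'S cap0 full.
by rewrite -[X in X *m z](proj_mx_id cap0 (submx_refl U)) -mulmxA -(zC _ eC)
  mulmxA proj_mx_sub.
Qed.

(** Conjugation by an element normalizing [S] is an automorphism of the commutant, so it preserves
    the centre. *)
Lemma center_commutant_conj S g z : g \in unitmx ->
    (forall s, S s -> S (g *m s *m invmx g)) ->
    (forall s, S s -> S (invmx g *m s *m g)) ->
  center_commutant S z -> center_commutant S (g *m z *m invmx g).
Proof.
move=> gU gS Sg [zS zC].
have conjC a s : comm_mx a (invmx g *m s *m g) -> comm_mx (g *m a *m invmx g) s.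
  rewrite /comm_mx => as_; have := congr1 (fun x => g *m x *m invmx g) as_.
  by rewrite /= !mulmxA !(mulmxK gU) (mulmxV gU) mul1mx => ->.
split=> [s Ss|f fS]; apply: conjC; first exact/zS/Sg.
apply: zC => s Ss; have /(congr1 (fun x => invmx g *m x *m g)) := fS _ (gS s Ss).
by rewrite /= /comm_mx !mulmxA !(mulmxKV gU) mulVmx // mul1mx.
Qed.

(** Schur's lemma: [conjmx B x] is the matrix of the restriction of [x] in the basis [B], and its
    kernel, carried back to vectors as [K], is a submodule. *)
Lemma simple_restrict_unit S m (B : 'M_(m, n)) x :
    simple_mx S B -> row_free B -> commutant S x -> stablemx B x ->
  conjmx B x != 0 -> conjmx B x \in unitmx.
Proof.
move=> [BS B0 Bmin] Bfree xS Bx; set r := conjmx B x => r0.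
pose K := kermx r *m B.
have rs s : S s -> comm_mx r (conjmx B s).
  by move=> Ss; rewrite /comm_mx /r -!conjmxM ?inE ?Bx ?BS // (xS _ Ss).
have KS : stable_under S <<K>>%MS.
  move=> s Ss; rewrite (eqmx_stable _ (genmxE K)) /K -mulmxA.
  have -> : B *m s = conjmx B s *m B by rewrite /conjmx mulmxKpV ?BS.
  by rewrite mulmxA submxMr // comm_mx_stable_ker //; apply: rs.
rewrite -row_free_unit -kermx_eq0; apply: contraNT r0 => ker0.
have K0 : (<<K>>)%MS != 0.
  rewrite -mxrank_eq0 genmxE mxrank_eq0; apply: contraNneq ker0 => K0.
  by apply/eqP/(row_free_inj Bfree); rewrite mul0mx.
have := Bmin _ KS; rewrite !genmxE => /(_ (submxMl _ _) K0).
case/submxP => D; rewrite -{1}(mul1mx B) mulmxA => /(row_free_inj Bfree) ker1.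
by rewrite -(mul1mx r) ker1 -mulmxA mulmx_ker mulmx0.
Qed.

End MatrixModules.

(** * Counting conjugates through their restrictions to simple submodules *)

Section RootsInSimpleModules.
Local Open Scope ring_scope.

(** [diff_roots] asks for commuting elements with invertible difference, the condition for bounding
    the number of roots over a noncommutative ring. *)
Lemma diff_roots_uniq (R : unitRingType) (rs : seq R) :
    {in rs &, forall x y, x != y -> diff_roots x y} -> uniq rs ->
  uniq_roots rs.
Proof.
elim: rs => //= x rs IH diff /andP[xrs rsU]; apply/andP; split.
  apply/allP => y yrs; apply: diff; rewrite ?mem_head ?inE ?yrs ?orbT //.
  by apply: contraNneq xrs => ->.
by apply: IH => // y z yrs zrs; apply: diff; rewrite inE ?yrs ?zrs orbT.
Qed.

Variables (F : fieldType) (n : nat).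
Implicit Types (S : set 'M[F]_n.+1).

(* The restrictions of the [zs] generate a field, in which [p] has fewer
   than [size p] roots. *)
Lemma size_restrict_roots S m (B : 'M_(m, n.+1)) (p : {poly F})
    (zs : seq 'M_n.+1) :
    simple_mx S B -> row_free B -> p != 0 ->
    {in zs, forall z, [/\ commutant S z, stablemx B z & horner_mx z p = 0]} ->
    {in zs &, forall x y, comm_mx x y} ->
  (size (undup [seq conjmx B z | z <- zs]) < size p)%N.
Proof.
case: m B => [|m] B BS Bfree p0 zsP zsC.
  by case: BS => _; rewrite [B]flatmx0 eqxx.
set rs := undup _.
have rsP y : y \in rs -> exists2 z, z \in zs & y = conjmx B z.
  by rewrite mem_undup => /mapP[z]; exists z.
(* Scalar matrices as coefficients make the restrictions roots of [q] in a matrix ring. *)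
pose q := map_poly (scalar_mx : F -> 'M_m.+1) p.
have <- : size q = size p.
  by rewrite size_map_inj_poly ?raddf0 //; apply: fmorph_inj.
apply: max_ring_poly_roots.
- rewrite -size_poly_eq0 size_map_inj_poly ?raddf0 ?size_poly_eq0 //.
  exact: fmorph_inj.
- apply/allP => _ /rsP[z /zsP[_ Bz zp] ->].
  have : horner_mx (conjmx B z) p = 0 by rewrite horner_mx_conj // zp conjmx0.
  by move/eqP.
apply: diff_roots_uniq; last exact: undup_uniq.
move=> _ _ /rsP[x xzs ->] /rsP[y yzs ->] xy.
have [xS Bx _] := zsP _ xzs; have [yS By _] := zsP _ yzs.
apply/andP; split.
  by apply/eqP; rewrite -[LHS]conjmxM ?inE // -[RHS]conjmxM ?inE // zsC.
have -> : conjmx B y - conjmx B x = conjmx B (y - x).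
  by rewrite /conjmx mulmxBr mulmxBl.
apply: (simple_restrict_unit BS) => //.
- move=> s Ss; apply/comm_mx_sym/comm_mxB; apply: comm_mx_sym.
    exact: yS.
  exact: xS.
- by rewrite stablemxD // stablemxN.
by apply: contraNneq xy; rewrite /conjmx mulmxBr mulmxBl => /subr0_eq ->.
Qed.

(** The [Ws] span, so [z i] is determined by its restrictions to them, of which each [W] sees at
    most [r]. *)
Lemma center_commutant_pigeonhole S (Ws : seq 'M_n.+1) (p : {poly F}) r
    (z : nat -> 'M_n.+1) :
    (forall W, W \in Ws -> simple_mx S W) ->
    (1%:M <= \sum_(W <- Ws) W)%MS ->
    p != 0 -> (size p <= r.+1)%N ->
    (forall i, center_commutant S (z i)) ->
    (forall i, horner_mx (z i) p = 0) ->
  exists i j, [/\ (i < j)%N, (j <= r.+1 ^ size Ws)%N & z i = z j].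
Proof.
move=> WsS Ws1 p0 sizep zC zp; set N := (_ ^ _)%N.
have Wz W i : W \in Ws -> stablemx W (z i).
  by case/WsS => WS _ _; apply: (center_commutant_stable WsS Ws1 WS).
pose L (W : 'M_n.+1) :=
  undup [seq conjmx (row_base W) x | x <- [seq z i | i <- iota 0 N.+1]].
have sizeL W : W \in Ws -> (size (L W) < r.+1)%N.
  move=> WWs; have WS := WsS _ WWs; apply: leq_trans sizep.
  apply: (@size_restrict_roots S) => //.
  - by apply: simple_mx_eqmx WS; apply/eqmx_sym/eq_row_base.
  - exact: row_base_free.
  - move=> _ /mapP[i _ ->]; split=> //; first by case: (zC i).
    by rewrite stablemx_row_base; apply: Wz.
  - by move=> _ _ /mapP[i _ ->] /mapP[j _ ->]; apply: (zC i).2; case: (zC j).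
(* The key records where each restriction stands in the list of distinct ones; there are [N]
   possible keys for [N.+1] indices. *)
pose key (i : 'I_N.+1) := [ffun c : 'I_(size Ws) =>
  inord (index (conjmx (row_base Ws`_c) (z i)) (L Ws`_c)) : 'I_r.+1].
have /injectivePn[i [j ij keyij]] : ~~ injectiveb key.
  apply/injectiveP => /leq_card; rewrite card_ord card_ffun !card_ord.
  by rewrite ltnn.
have zij : z i = z j.
  apply/eqP; rewrite -subr_eq0 -[_ - _]mul1mx.
  rewrite (sameP eqP sub_kermxP); apply: submx_trans Ws1 _.
  apply/sumsmx_seqP => W WWs; apply/sub_kermxP/eqP.
  have mem l : (l < N.+1)%N -> conjmx (row_base W) (z l) \in L W.
    by move=> lN; rewrite mem_undup map_f // map_f // mem_iota.
  have lt_index l : (l < N.+1)%N ->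
      (index (conjmx (row_base W) (z l)) (L W) < r.+1)%N.
    by move=> /mem; rewrite -index_mem => /leq_trans-> //; apply/ltnW/sizeL.
  have ltW : (index W Ws < size Ws)%N by rewrite index_mem.
  have := congr1 (fun f : {ffun 'I__ -> 'I__} => f (Ordinal ltW) : nat) keyij.
  rewrite !ffunE /= nth_index // !inordK ?lt_index ?ltn_ord //.
  move/(index_inj 0 (mem _ (ltn_ord i)) (mem _ (ltn_ord j))) => conjij.
  have Bz l : stablemx (row_base W) (z l) by rewrite stablemx_row_base Wz.
  have Bzij : row_base W *m z i = row_base W *m z j.
    by rewrite -(mulmxKpV (Bz i)) -[RHS](mulmxKpV (Bz j)); congr (_ *m _).
  have /submxP[D ->] : (W <= row_base W)%MS by rewrite eq_row_base.
  by rewrite -mulmxA mulmxBr Bzij subrr mulmx0.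
case: (ltngtP i j) => [ltij|ltji|/val_inj eqij].
- by exists i, j; rewrite ltij -ltnS ltn_ord.
- by exists j, i; rewrite ltji -ltnS ltn_ord.
- by rewrite eqij eqxx in ij.
Qed.

Lemma center_commutant_period S (Ws : seq 'M_n.+1) g z :
    (forall W, W \in Ws -> simple_mx S W) -> (size Ws <= n.+1)%N ->
    (1%:M <= \sum_(W <- Ws) W)%MS ->
    g \in unitmx ->
    (forall s, S s -> S (g *m s *m invmx g)) ->
    (forall s, S s -> S (invmx g *m s *m g)) ->
    center_commutant S z ->
  GRing.comm z (g ^+ (n.+2 ^ n.+1)`!).
Proof.
move=> WsS ltWs Ws1 gU gS Sg zC; pose c x := g *m x *m invmx g.
have c_inj : injective c.
  move=> x y /(congr1 (fun u => invmx g *m u *m g)).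
  by rewrite /c !mulmxA !mulmxKV // mulVmx // !mul1mx.
(* The [i]-th iterate of [c] is conjugation by [g ^+ i], written without inverses. *)
have cE i x : iter i c x * g ^+ i = g ^+ i * x.
  elim: i x => [|i IH] x; first by rewrite mulr1 mul1r.
  rewrite iterSr exprSr mulrA IH /c -!mulrA; congr (_ * _).
  by rewrite -[LHS]/(_ *m (_ *m _)) !mulmxA mulmxKV.
have cC i : center_commutant S (iter i c z).
  by elim: i => // i; apply: center_commutant_conj.
(* Conjugates satisfy the same polynomial, of size [n.+2]; hence [r = n.+1] below. *)
have cp i : horner_mx (iter i c z) (char_poly z) = 0.
  elim: i => [|i IH]; first exact: Cayley_Hamilton.
  by rewrite iterS horner_mx_uconj // IH mulmx0 mul0mx.
have [||i [j [ltij leN zij]]] :=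
    center_commutant_pigeonhole (r := n.+1) WsS Ws1 _ _ cC cp.
- by rewrite monic_neq0 // char_poly_monic.
- by rewrite size_char_poly.
have zji : iter (j - i) c z = z.
  have ic_inj : injective (iter i c).
    by elim: i {ltij zij} => // i IH x y /c_inj/IH.
  by apply: ic_inj; rewrite -iterD subnKC // ltnW.
have comm_ji : GRing.comm z (g ^+ (j - i)) by rewrite /GRing.comm -{1}zji cE.
(* The period [j - i] varies with [g] and [z], but being at most [n.+2 ^ n.+1] it divides the
   factorial, which is a uniform exponent. *)
have /dvdnP[q ->] : (j - i %| (n.+2 ^ n.+1)`!)%N.
  apply: dvdn_fact; rewrite subn_gt0 ltij /= (leq_trans (leq_subr _ _)) //.
  by rewrite (leq_trans leN) // leq_pexp2l.
by rewrite mulnC exprM; apply: commrX.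
Qed.

End RootsInSimpleModules.

(** * The uniform exponent for matrix groups *)

Section Period.
Local Open Scope ring_scope.

(** The power is an iterated product because ['M_n] has its ring structure only for successor
    [n]. *)
Lemma semisimple_center_period (F : fieldType) n (Gs Hs : set 'M[F]_n)
    (Us : seq 'M_n) g z :
    (forall g, Gs g -> g \in unitmx) ->
    (forall g, Gs g -> Gs (invmx g)) ->
    (forall g h, Gs g -> Hs h -> Hs (g *m h *m invmx g)) ->
    Hs `<=` Gs ->
    (forall U, U \in Us -> simple_mx Gs U) ->
    (1%:M <= \sum_(U <- Us) U)%MS ->
    Gs g -> center_commutant Hs z ->
  comm_mx z (iter (n.+1 ^ n)`! (mulmx g) 1%:M).
Proof.
case: n Gs Hs Us g z => [|n] Gs Hs Us g z GU GV GH HG UsG Us1 Gg zC.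
  by rewrite [z]flatmx0; apply: comm0mx.
have [Ws [WsH ltWs Ws1]] := Clifford GU GV GH HG UsG Us1.
have := center_commutant_period WsH ltWs Ws1 (GU _ Gg) _ _ zC.
rewrite -iter_mulr_1; apply=> s Hs_s; first exact: GH.
by have := GH _ _ (GV _ Gg) Hs_s; rewrite invmxK.
Qed.


End Period.

(** * Translation of representations into matrices *)

Section LinearRepresentation.
Local Open Scope ring_scope.

Import passmx.

Variables (G : topologicalGroupType) (k : topologicalFieldType).
Variables (V : vectType k) (rho : G -> 'End(V)).
Hypothesis rhoM : linear_rep rho.

Local Notation e := (vbasis {:V}).
Local Notation mx f := (mxof e e f).
Let eB : basis_of {:V} e := vbasisP _.
Local Notation R g := (mx (rho g)).

Let mx_inj : injective (fun f : 'End(V) => mx f).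
Proof. exact: can_inj (mxofK eB eB). Qed.

Lemma comm_mxofP (f g : 'End(V)) :
  (f \o g)%VF = (g \o f)%VF <-> comm_mx (mx f) (mx g).
Proof.
rewrite /comm_mx -!(mxof_comp _ _ eB); split=> [->//|/mx_inj//].
Qed.

(** Row vectors reverse the order of products. *)
Lemma rep_mxM x y : R (x * y)%g = R y *m R x.
Proof. by rewrite rhoM.2 (mxof_comp _ _ eB). Qed.

Lemma rep_mx1 : R 1%g = 1%:M.
Proof. by rewrite rhoM.1 mxof1 // (basis_free eB). Qed.

Lemma rep_mxVK x : R x *m R x^-1%g = 1%:M.
Proof. by rewrite -rep_mxM mulVg rep_mx1. Qed.

Lemma rep_mx_unit x : R x \in unitmx.
Proof. by have [] := mulmx1_unit (rep_mxVK x). Qed.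

Lemma rep_mxV x : R x^-1%g = invmx (R x).
Proof. by rewrite -[LHS](mulKmx (rep_mx_unit x)) rep_mxVK mulmx1. Qed.

Lemma rep_mxX x i : R (x ^+ i)%g = iter i (mulmx (R x)) 1%:M.
Proof.
by elim: i => [|i IH]; rewrite ?expg0 ?rep_mx1 // expgSr rep_mxM IH.
Qed.

Lemma limg_sub_msof (f : 'End(V)) (U : {vspace V}) :
  (f @: U <= U)%VS = stablemx (msof e U) (mx f).
Proof.
rewrite -[in LHS](limg_proj U) -limg_comp (limgE eB) vsof_sub // (mxof_comp _ _ eB).
by rewrite limg_proj.
Qed.

Lemma submodule_msof (U : {vspace V}) :
  submodule rho U <-> stable_under (range (fun g => R g)) (msof e U).
Proof.
split=> [US _ [g _ <-]|US g]; first by rewrite -limg_sub_msof.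
by rewrite limg_sub_msof; apply: US; exists g.
Qed.

Lemma simple_submodule_msof (U : {vspace V}) :
  simple_submodule rho U -> simple_mx (range (fun g => R g)) (msof e U).
Proof.
move=> [US U0 Umin]; split; first exact/submodule_msof.
  by rewrite msof_eq0 //; apply/eqP.
move=> X XS XU X0; have eqX := eqmxP (vsofK eB X).
have [||/eqP|XeqU] := Umin (vsof e X).
- by apply/submodule_msof; apply: stable_under_eqmx XS; apply: eqmx_sym.
- by rewrite vsof_sub.
- by rewrite vsof_eq0 // (negPf X0).
by rewrite -XeqU eqX.
Qed.

Lemma semisimple_rep_msof : semisimple_rep rho ->
  exists2 Us : seq 'M_(\dim {:V}),
    forall U, U \in Us -> simple_mx (range (fun g => R g)) U &
    (1%:M <= \sum_(U <- Us) U)%MS.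
Proof.
move=> [m [U [UsS _ Usfull]]].
exists [seq msof e (U i) | i <- enum 'I_m].
  by move=> _ /mapP[i _ ->]; apply: simple_submodule_msof.
set X := (\sum_(W <- _) W)%MS; suff UX : (fullv <= vsof e X)%VS.
  apply: (@submx_trans _ _ _ _ _ _ (msof e fullv)); rewrite ?msof_sub //.
  by rewrite -vsof_sub ?subvf.
apply: (@subv_trans _ _ (\sum_i U i)%VS); first by rewrite Usfull.
apply/subv_sumP => i _; rewrite -msof_sub //.
by have /sumsmx_seqP := submx_refl X; apply; apply: map_f; rewrite mem_enum.
Qed.

(** Every matrix comes from an endomorphism, so commuting with the whole commutant carries over. *)
Lemma centerEnd_mxof (H : set G) (z : 'End(V)) :
  centerEnd (End_rep rho H) z ->
  center_commutant [set R h | h in H] (mx z).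
Proof.
move=> [zH zC]; split=> [_ [h Hh <-]|f fH].
  by apply/comm_mxofP/zH.
rewrite -[f](hommxK eB eB); apply/comm_mxofP/zC => h Hh.
by apply/comm_mxofP; rewrite hommxK //; apply: fH; exists h.
Qed.

Lemma centerEnd_comm_expg (H : set G) z x :
    closed_normal_subgroup H -> semisimple_rep rho ->
    centerEnd (End_rep rho H) z ->
  (z \o rho (x ^+ ((\dim {:V}).+1 ^ \dim {:V})`!)%g =
   rho (x ^+ ((\dim {:V}).+1 ^ \dim {:V})`!)%g \o z)%VF.
Proof.
move=> HN /semisimple_rep_msof[Us UsG Us1] /centerEnd_mxof zC.
apply/comm_mxofP; rewrite rep_mxX.
apply: (semisimple_center_period _ _ _ _ UsG Us1 _ zC); last by exists x.
- by move=> _ [g _ <-]; apply: rep_mx_unit.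
- by move=> _ [g _ <-]; rewrite -rep_mxV; exists g^-1%g.
(* Since products are reversed, conjugating [R h] by [R g] gives [R (h ^ g)]. *)
- move=> _ _ [g _ <-] [h Hh <-]; rewrite -rep_mxV -!rep_mxM.
  by exists (h ^ g)%g; [apply: cns_conj | rewrite conjgE mulgA].
- by move=> _ [h _ <-]; exists h.
Qed.

End LinearRepresentation.

(** * From powers in [G] to the preimage of the powers in [Gamma] *)

Theorem theorem3p6 (d : nat) (d_gt0 : (0 < d)%N) :
  exists n : nat, (0 < n)%N /\
    forall (G : topologicalGroupType) (H : set G)
      (Gamma : topologicalGroupType) (pi : G -> Gamma)
      (k : topologicalFieldType) (V : vectType k) (rho : G -> 'End(V)),
      profinite G ->
      closed_normal_subgroup H ->
      quotient_group_map H pi ->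
      procyclic Gamma ->
      locally_compact_field k ->
      \dim {:V} = d ->
      linear_rep rho ->
      continuous_rep rho ->
      semisimple_rep rho ->
      centerEnd (End_rep rho H) `<=` End_rep rho (preimage_power pi n).
Proof.
exists (d.+1 ^ d)`!; split; first exact: fact_gt0.
move=> G H Gamma pi k V rho _ HN piQ _ _ dimV rhoM _ rhoS z zC s [c].
have [x <-] := qgm_surj piQ c => pis.
have pi1 : pi 1%g = 1%g by apply/(qgm_ker piQ)/(cns_one HN).
have piX i : pi (x ^+ i)%g = (pi x ^+ i)%g.
  by elim: i => [|i IH]; rewrite ?expg0 ?pi1 // expgS (qgm_morph piQ) IH expgS.
set y := (x ^+ (d.+1 ^ d)`!)%g.
(* [s] and the power [y] have the same image in [Gamma], so [s] is [y] times an element of [H]; [z]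
   commutes with the action of both factors. *)
have Hys : H (y^-1 * s)%g.
  apply/(qgm_ker piQ); rewrite (qgm_morph piQ) pis -piX -(qgm_morph piQ).
  by rewrite mulVg.
have zy : (z \o rho y = rho y \o z)%VF.
  by have := centerEnd_comm_expg rhoM x HN rhoS zC; rewrite dimV.
have -> : s = (y * (y^-1 * s))%g by rewrite mulgA mulgV mul1g.
by rewrite rhoM.2 comp_lfunA zy -comp_lfunA zC.1 // comp_lfunA.
Qed.
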